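(* Let $\mu$ be a finite Borel measure on $\mathbb{R}$ that is continuous (has no atoms). Let $m>\varsigma\ge0$ be real numbers. Assume that there exists a Borel set $A\subset\mathbb{R}$ with $\mu(A)>0$ such that for all $x\in A$, $$\liminf_{\epsilon\to0+}\epsilon^{-\varsigma}J_{\mu,m}(x,\epsilon)>0.$$ Then for every $q>1$, $$D_\mu^+(q)\le\frac{m\varsigma}{m-\varsigma}.$$ If moreover there is $\delta>0$ such that $\gamma_\mu^-(x)\ge\delta$ for all $x\in A$, then for every $q>1$, $$D_\mu^+(q)\le\frac{\varsigma(m-\delta)}{m-\varsigma}.$$
   Context: For $m>0$, $x\in\mathbb{R}$, $\epsilon>0$, the $m$-Borel transform of $\mu$ is $J_{\mu,m}(x,\epsilon)=\epsilon^m\int_{\mathbb{R}}\frac{d\mu(y)}{|x-y|^m+\epsilon^m}$. For $x\in\mathrm{supp}\,\mu$, $\gamma_\mu^-(x)=\liminf_{\epsilon\to0+}\frac{\log\mu([x-\epsilon,x+\epsilon])}{\log\epsilon}$. For $q>0$ and $\epsilon>0$, let $S_\mu(q,\epsilon)=\sum_{j\in\mathbb{Z}}\big(\mu([j\epsilon,(j+1)\epsilon))\big)^q$. The upper multifractal dimension is $D_\mu^+(q)=\limsup_{\epsilon\to0+}\frac{\log S_\mu(q,\epsilon)}{(q-1)\log\epsilon}$. *)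

(* Defs.v *)
From HB Require Import structures.
From mathcomp Require Import all_boot all_order all_algebra.
From mathcomp Require Import all_classical all_reals all_analysis.
Set Implicit Arguments.
Unset Strict Implicit.
Unset Printing Implicit Defensive.
Import Order.TTheory GRing.Theory Num.Theory.
Import numFieldNormedType.Exports.

Local Open Scope classical_set_scope.
Local Open Scope ring_scope.
Local Open Scope ereal_scope.

(* All quantities are extended-real valued, and logarithms of masses are taken
   with lne, for which lne 0 = -oo. *)

Definition borel_transform (R : realType)
    (mu : {measure set (measurableTypeR R) -> \bar R}) (m x eps : R) : \bar R :=
  (eps `^ m)%:E *
  \int[mu]_(y in setT) (((`|x - y| `^ m + eps `^ m)^-1)%R)%:E.

(* Intended for x in the support of mu; off the support the masses vanish for
   small eps and the value is +oo. *)
Definition lower_local_dim (R : realType)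
    (mu : {measure set (measurableTypeR R) -> \bar R}) (x : R) : \bar R :=
  limf_einf (fun eps : R =>
    lne (mu `[(x - eps)%R, (x + eps)%R]%classic) * (((ln eps)^-1)%R)%:E)
    (0%R : R)^'+.

Definition mass_sum (R : realType)
    (mu : {measure set (measurableTypeR R) -> \bar R}) (q eps : R) : \bar R :=
  \esum_(j in [set: int])
    (mu `[(j%:~R * eps)%R, ((j + 1)%:~R * eps)%R[%classic `^ q).

Definition upper_mf_dim (R : realType)
    (mu : {measure set (measurableTypeR R) -> \bar R}) (q : R) : \bar R :=
  limf_esup (fun eps : R =>
    lne (mass_sum mu q eps) * ((((q - 1) * ln eps)^-1)%R)%:E)
    (0%R : R)^'+.

(* Main.v *)
Require Import Defs.
From HB Require Import structures.
From mathcomp Require Import all_boot all_order all_algebra.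
From mathcomp Require Import all_classical all_reals all_analysis.
From mathcomp Require Import measurable_realfun ring lra.
Import Order.TTheory GRing.Theory Num.Theory.
Import numFieldNormedType.Exports.
Local Open Scope classical_set_scope.
Local Open Scope ring_scope.
Local Open Scope ereal_scope.

(** Let J be the m-Borel transform and suppose mu(B(x,r)) <= K r^d for all r,
    with 0 <= d < m; d = 0 is always possible, and every d < delta is possible
    when the lower local dimension is at least delta > d.  Splitting the
    integral at distance r gives J(x,eps) <= mu(B(x,r)) + C eps^m r^(d-m).
    Choosing eps so that the last term is half of the lower bound c eps^s on J
    yields mu(B(x,r)) >= c' r^a with a = s(m-d)/(m-s).  The constants can be made
    uniform on a set E of positive mass, and then S(q,eps) is at least of order
    eps^(a(q-1)) mu(E), because a cell meeting E and its two neighbours have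
    total mass at least c' eps^a.  This gives upper dimension at most a.  In
    the second part d tends to delta when delta <= s; when delta > s one may take
    s < d < delta, and then a < d makes the two ball estimates contradictory. *)

(** * Limits at 0 from the right, and enumeration of the integers *)

Lemma near_at_right0 (R : realType) (P : R -> Prop) :
  (\forall e \near (0%R : R)^'+, P e) ->
  exists2 e0 : R, (0 < e0)%R & forall e : R, (0 < e < e0)%R -> P e.
Proof.
case => e0 /= e0_gt0 eP; exists e0 => // e /andP[e_gt0 e_lt].
by apply: eP => //=; rewrite sub0r normrN gtr0_norm.
Qed.

Lemma limf_esup_le (R : realType) (f : R -> \bar R) (F : set (set R)) (b : \bar R) :
  F [set x | f x <= b] -> limf_esup f F <= b.
Proof.
move=> Fb; rewrite limf_esupE; apply: ge_ereal_inf.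
exists (ereal_sup [set f x | x in [set x | f x <= b]]); first by exists [set x | f x <= b].
by apply: ub_ereal_sup => _ [x ? <-].
Qed.

Lemma lt_limf_einf (R : realType) (f : R -> \bar R) (F : set (set R))
    (FF : Filter F) (b : \bar R) :
  b < limf_einf f F -> F [set x | b < f x].
Proof.
rewrite limf_einfE => /ereal_sup_gt[_ [V FV <-] bV].
apply: filterS FV => x Vx; apply: lt_le_trans bV _.
by apply: ereal_inf_lbound; exists x.
Qed.

(** Turns sums over [int] into series over [nat], where sigma-subadditivity and scaling apply. *)
Lemma bij_nat_int : exists e : nat -> int, set_bij [set: nat] [set: int] e.
Proof.
pose intp : pointedType := HB.pack int (isPointed.Build int 0%R).
have infZ : infinite_set [set: intp].
  by apply/infiniteP/pcard_leTP/injPex; exists Posz => // m n _ _ [->].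
have : ([set: nat] #= [set: intp])%card.
  rewrite card_eq_sym.
  by apply: eq_card_nat; [exact: (@countableP int)|exact: infZ].
by move=> /card_set_bijP[e ebij]; exists e.
Qed.

(** * Upper estimate of the Borel transform, splitting at radius r *)

Lemma measurable_borel_kernel (R : realType) (m x eps : R)
    (D : set (measurableTypeR R)) :
  measurable_fun D (EFin \o (fun y : measurableTypeR R =>
    (`|x - y| `^ m + eps `^ m)^-1)%R).
Proof.
apply: measurable_funTS; apply/measurable_EFinP.
rewrite [X in measurable_fun _ X](_ : _ =
    (fun z : R => (z `^ (-1))%R) \o (fun y : R => (`|x - y| `^ m + eps `^ m)%R)).
  apply: measurableT_comp; first exact: measurable_powR.
  apply: measurable_funD => //.
  apply: (measurableT_comp (measurable_powR m)).
  apply: measurableT_comp => //.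
  exact: measurable_funB.
by apply/funext => y /=; rewrite powR_inv1// addr_ge0// powR_ge0.
Qed.

Lemma borel_kernel_ge0 (R : realType) (m x eps y : R) :
  0 <= (((`|x - y| `^ m + eps `^ m)^-1)%R)%:E.
Proof. by rewrite lee_fin invr_ge0 addr_ge0// powR_ge0. Qed.

Lemma integral_borel_kernel_le (R : realType)
    (mu : {measure set (measurableTypeR R) -> \bar R}) (m x eps c : R)
    (D : set (measurableTypeR R)) : measurable D ->
  (forall y, D y -> ((`|x - y| `^ m + eps `^ m)^-1 <= c)%R) ->
  \int[mu]_(y in D) (((`|x - y| `^ m + eps `^ m)^-1)%R)%:E <= c%:E * mu D.
Proof.
move=> mD Dc; rewrite -(integral_cst mu mD c%:E).
apply: ge0_le_integral => //=.
- by move=> y _; exact: borel_kernel_ge0.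
- exact: measurable_borel_kernel.
Qed.

Lemma borel_kernel_le_outside (R : realType) (m x eps r y : R) :
  (0 < m)%R -> (0 < r)%R -> (~` `[(x - r)%R, (x + r)%R]%classic) y ->
  ((`|x - y| `^ m + eps `^ m)^-1 <= r `^ (- m))%R.
Proof.
move=> m0 r0 /= By.
have ry : (r <= `|x - y|)%R.
  rewrite leNgt; apply/negP => ry; apply: By; rewrite in_itv /=.
  by move: ry; rewrite ltr_norml => /andP[? ?]; apply/andP; split; lra.
rewrite powRN lef_pV2 ?posrE ?powR_gt0//; last first.
  by rewrite ltr_pwDl// ?powR_gt0 ?powR_ge0// (lt_le_trans r0).
rewrite (@le_trans _ _ (`|x - y| `^ m)%R)// ?lerDl ?powR_ge0//.
by rewrite ge0_ler_powR ?nnegrE// ltW.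
Qed.

(* The domain is split into the annulus up to [2 * r] and the tail beyond it. *)
Lemma integral_borel_kernel_tail_rec (R : realType)
    (mu : {measure set (measurableTypeR R) -> \bar R}) (m x eps K d r : R) :
  (0 < m)%R -> (0 < r)%R ->
  mu `[(x - 2 * r)%R, (x + 2 * r)%R]%classic <= (K * (2 * r) `^ d)%:E ->
  \int[mu]_(y in ~` `[(x - r)%R, (x + r)%R]) (((`|x - y| `^ m + eps `^ m)^-1)%R)%:E
  <= (K * 2 `^ d * r `^ (d - m))%:E +
  \int[mu]_(y in ~` `[(x - 2 * r)%R, (x + 2 * r)%R])
     (((`|x - y| `^ m + eps `^ m)^-1)%R)%:E.
Proof.
move=> m0 r0 muB.
set B := (`[(x - r)%R, (x + r)%R]%classic : set (measurableTypeR R)).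
set B2 := (`[(x - 2 * r)%R, (x + 2 * r)%R]%classic : set (measurableTypeR R)).
have mB : measurable B by exact: measurable_itv.
have mB2 : measurable B2 by exact: measurable_itv.
have BB2 : B `<=` B2.
  by move=> y /=; rewrite /B /B2 /= !in_itv /= => /andP[? ?]; apply/andP; split; lra.
have -> : ~` B = (B2 `\` B) `|` ~` B2.
  apply/seteqP; split=> y; last by case=> [[]//|nB2 By]; exact/nB2/BB2.
  by have [B2y nBy|nB2y _] := pselect (B2 y); [left|right].
rewrite ge0_integral_setU//; last 5 first.
- exact: measurableD.
- exact: measurableC.
- exact: measurable_borel_kernel.
- by move=> y _; exact: borel_kernel_ge0.
- by apply/disj_setPS => y [[/= ? _]].
apply: leeD2r.
apply: le_trans (integral_borel_kernel_le _ _ _ _ _ (r `^ (- m))%R _ _ _) _.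
- exact: measurableD.
- by move=> y [_]; exact: borel_kernel_le_outside.
apply: (@le_trans _ _ ((r `^ (- m))%:E * (K * (2 * r) `^ d)%:E)).
  rewrite lee_pmul2l// ?lte_fin ?powR_gt0//.
  by apply: le_trans muB; apply: le_measure; rewrite ?inE//; exact: measurableD.
rewrite -EFinM lee_fin powRM ?(ltW r0)// powRD; last by apply/implyP => _; rewrite gt_eqF.
by rewrite le_eqVlt; apply/orP; left; apply/eqP; ring.
Qed.

(* Induction on the recursion above; the equation on [C] says that it sums the
   geometric series of the annuli. *)
Lemma integral_borel_kernel_tail_iter (R : realType)
    (mu : {measure set (measurableTypeR R) -> \bar R}) (m x eps K d M C : R) :
  (0 < m)%R -> mu setT <= M%:E ->
  (C = K * 2 `^ d + C * 2 `^ (d - m))%R -> (0 <= C)%R ->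
  (forall r : R, (0 < r)%R ->
    mu `[(x - r)%R, (x + r)%R]%classic <= (K * r `^ d)%:E) ->
  forall (n : nat) (r : R), (0 < r)%R ->
  \int[mu]_(y in ~` `[(x - r)%R, (x + r)%R]) (((`|x - y| `^ m + eps `^ m)^-1)%R)%:E
  <= (C * r `^ (d - m) + M * (2 ^+ n * r) `^ (- m))%:E.
Proof.
move=> m0 muM CE C0 muB; elim=> [|n IH] r r0.
- set B := (`[(x - r)%R, (x + r)%R]%classic : set (measurableTypeR R)).
  have mB : measurable (~` B) by apply: measurableC; exact: measurable_itv.
  apply: le_trans (integral_borel_kernel_le _ _ _ _ _ (r `^ (- m))%R _ mB _) _.
    move=> y By; apply: borel_kernel_le_outside => //.
  apply: (@le_trans _ _ ((r `^ (- m))%:E * M%:E)).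
    rewrite lee_pmul2l// ?lte_fin ?powR_gt0//.
    by apply: le_trans muM; apply: le_measure; rewrite ?inE.
  rewrite expr0 mul1r -EFinM lee_fin [leLHS]mulrC lerDr.
  by rewrite mulr_ge0// powR_ge0.
- apply: le_trans (integral_borel_kernel_tail_rec _ _ _ _ _ K d _ m0 r0 _) _.
    by apply: muB; lra.
  apply: le_trans (leeD2l _ (IH _ _)) _; first lra.
  rewrite -EFinD lee_fin exprSr -[(2 ^+ n * 2 * r)%R]mulrA (@powRM _ 2 r)// ?(ltW r0)//.
  rewrite le_eqVlt; apply/orP; left; apply/eqP.
  by rewrite [in RHS]CE; ring.
Qed.

(** The bound after n doublings carries the remainder M (2^n r)^(-m), which is geometric of ratio
    2^(-m) < 1 and so falls below any e > 0. *)
Lemma integral_borel_kernel_tail_le (R : realType)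
    (mu : {measure set (measurableTypeR R) -> \bar R}) (m x eps K d M C : R) :
  (0 < m)%R -> mu setT <= M%:E ->
  (C = K * 2 `^ d + C * 2 `^ (d - m))%R -> (0 <= C)%R ->
  (forall r : R, (0 < r)%R ->
    mu `[(x - r)%R, (x + r)%R]%classic <= (K * r `^ d)%:E) ->
  forall r : R, (0 < r)%R ->
  \int[mu]_(y in ~` `[(x - r)%R, (x + r)%R]) (((`|x - y| `^ m + eps `^ m)^-1)%R)%:E
  <= (C * r `^ (d - m))%:E.
Proof.
move=> m0 muM CE C0 muB r r0; apply/lee_addgt0Pr => e e0.
have q1 : (`|2 `^ (- m) : R| < 1)%R.
  rewrite ger0_norm ?powR_ge0// powRN invf_lt1 ?powR_gt0//.
  rewrite [ltLHS](_ : _ = 1 `^ m)%R; last by rewrite powR1.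
  by apply: gt0_ltr_powR => //; rewrite ?nnegrE// ltr1n.
have := cvg_geometric (M * r `^ (- m))%R q1.
move=> /cvgrPdist_lt /(_ e e0) [n _ /(_ n (leqnn n))] /=.
rewrite sub0r normrN => /ltW Me.
apply: le_trans (integral_borel_kernel_tail_iter _ _ _ _ _ _ _ _ _ m0 muM CE C0 muB n r r0) _.
rewrite -EFinD lee_fin lerD2l; apply: le_trans Me; apply: le_trans (ler_norm _).
rewrite powRM ?exprn_ge0 ?(ltW r0)// -!powR_mulrn ?powR_ge0// powRAC.
by rewrite -mulrA [(_ * r `^ _)%R]mulrC.
Qed.

(** On the ball the kernel is at most eps^(-m), which cancels the prefactor eps^m and leaves the
    mass of the ball; outside it the tail estimate applies. *)
Lemma borel_transform_le (R : realType)
    (mu : {measure set (measurableTypeR R) -> \bar R}) (m x K d M C : R) :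
  (0 < m)%R -> mu setT <= M%:E ->
  (C = K * 2 `^ d + C * 2 `^ (d - m))%R -> (0 <= C)%R ->
  (forall r : R, (0 < r)%R ->
    mu `[(x - r)%R, (x + r)%R]%classic <= (K * r `^ d)%:E) ->
  forall r eps : R, (0 < r)%R -> (0 < eps)%R ->
  borel_transform mu m x eps <=
  mu `[(x - r)%R, (x + r)%R]%classic + (C * eps `^ m * r `^ (d - m))%:E.
Proof.
move=> m0 muM CE C0 muB r eps r0 eps0; rewrite /borel_transform.
set B := (`[(x - r)%R, (x + r)%R]%classic : set (measurableTypeR R)).
have mB : measurable B by exact: measurable_itv.
rewrite -[setT](setvU B) ge0_integral_setU//; last 4 first.
- exact: measurableC.
- exact: measurable_borel_kernel.
- by move=> y _; exact: borel_kernel_ge0.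
- by apply/disj_setPS => y [].
rewrite ge0_muleDr; last 2 first.
- by apply: integral_ge0 => y _; exact: borel_kernel_ge0.
- by apply: integral_ge0 => y _; exact: borel_kernel_ge0.
rewrite addeC; apply: leeD.
- have e0 : 0 <= (eps `^ m)%:E by rewrite lee_fin powR_ge0.
  apply: (le_trans (lee_wpmul2l e0
    (integral_borel_kernel_le _ _ _ _ _ (eps `^ m)^-1%R _ mB _))).
    move=> y _; rewrite lef_pV2 ?posrE ?powR_gt0//.
      by rewrite lerDr powR_ge0.
    by rewrite ltr_wpDl ?powR_gt0// powR_ge0.
  by rewrite muleA -EFinM divff ?mul1e// gt_eqF// powR_gt0.
- have e0 : 0 <= (eps `^ m)%:E by rewrite lee_fin powR_ge0.
  apply: (le_trans (lee_wpmul2l e0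
    (integral_borel_kernel_tail_le _ _ _ _ _ _ _ _ _ m0 muM CE C0 muB r r0))).
  by rewrite -EFinM lee_fin mulrA [(_ * C)%R]mulrC.
Qed.

(** * From growth of the Borel transform to lower bounds on ball masses *)

Lemma powR_invK (R : realType) (a t : R) : (0 <= t)%R -> a != 0%R ->
  ((t `^ a^-1) `^ a = t)%R.
Proof. by move=> t0 a0; rewrite -powRrM mulVf// powRr1. Qed.

Lemma ball_mass_lower_bound (R : realType)
    (mu : {finite_measure set (measurableTypeR R) -> \bar R})
    (m s x K d c e0 : R) :
  (s < m)%R -> (0 < m)%R -> (d < m)%R -> (0 < K)%R -> (0 < c)%R -> (0 < e0)%R ->
  (forall r : R, (0 < r)%R ->
    mu `[(x - r)%R, (x + r)%R]%classic <= (K * r `^ d)%:E) ->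
  (forall eps : R, (0 < eps < e0)%R ->
    c%:E <= (eps `^ (- s))%:E * borel_transform mu m x eps) ->
  exists2 c' : R, (0 < c')%R & exists2 r0 : R, (0 < r0)%R &
    forall r : R, (0 < r < r0)%R ->
    (c' * r `^ (s * (m - d) / (m - s)))%:E <= mu `[(x - r)%R, (x + r)%R]%classic.
Proof.
move=> sm m0 dm K0 c0 e00 muB Jc.
have md0 : (0 < m - d)%R by rewrite subr_gt0.
have ms0 : (0 < m - s)%R by rewrite subr_gt0.
have q1 : (2 `^ (d - m) < 1 :> R)%R.
  rewrite -opprB powRN invf_lt1 ?powR_gt0//.
  rewrite [ltLHS](_ : _ = 1 `^ (m - d))%R; last by rewrite powR1.
  by apply: gt0_ltr_powR => //; rewrite ?nnegrE// ltr1n.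
(* The solution of the geometric series equation [CE], positive because d < m. *)
pose C := (K * 2 `^ d / (1 - 2 `^ (d - m)))%R.
have q0 : (0 < 1 - 2 `^ (d - m) :> R)%R by rewrite subr_gt0.
have C0 : (0 < C)%R by rewrite /C !mulr_gt0// ?invr_gt0// powR_gt0.
have CE : (C = K * 2 `^ d + C * 2 `^ (d - m))%R by rewrite /C; field; rewrite gt_eqF.
have muM : mu setT <= (fine (mu setT))%:E by rewrite fineK// fin_num_measure.
(* With e^(m-s) = L r^(m-d), this value makes the tail term C e^m r^(d-m) equal to e^s c/2, half of
   the lower bound on the transform. *)
pose L := (c / (2 * C))%R.
have L0 : (0 < L)%R by rewrite /L divr_gt0// mulr_gt0.
exists (c / 2 * L `^ (s / (m - s)))%R.
  by rewrite mulr_gt0 ?powR_gt0// divr_gt0.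
(* The radius at which the scale e chosen below equals e0; smaller radii give e < e0. *)
exists ((e0 `^ (m - s) / L) `^ (m - d)^-1)%R.
  by rewrite powR_gt0// divr_gt0// powR_gt0.
move=> r /andP[r0 rlt].
pose e := ((L * r `^ (m - d)) `^ (m - s)^-1)%R.
have Lr0 : (0 < L * r `^ (m - d))%R by rewrite mulr_gt0// powR_gt0.
have ep : (0 < e)%R by rewrite powR_gt0.
have ems : (e `^ (m - s) = L * r `^ (m - d))%R.
  by rewrite powR_invK// ?(ltW Lr0)// gt_eqF.
have elt : (e < e0)%R.
  rewrite -[ltRHS](powRr1 (ltW e00)) -(mulfV (lt0r_neq0 ms0)) powRrM.
  apply: gt0_ltr_powR; rewrite ?invr_gt0 ?nnegrE ?powR_ge0 ?(ltW Lr0)//.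
  rewrite mulrC -ltr_pdivlMr// -[ltRHS](@powR_invK _ (m - d))//; last 2 first.
  - by rewrite divr_ge0 ?powR_ge0 ?ltW.
  - by rewrite gt_eqF.
  by apply: gt0_ltr_powR; rewrite ?nnegrE ?powR_ge0 ?(ltW r0).
have := Jc e; rewrite ep elt => /(_ isT) Je.
have := borel_transform_le _ mu m x K d _ C m0 muM CE (ltW C0) muB r e r0 ep.
move=> Hb.
have muBfin : mu `[(x - r)%R, (x + r)%R]%classic \is a fin_num.
  by rewrite fin_num_measure//; exact: measurable_itv.
rewrite -(fineK muBfin); set b := fine _.
have H : c%:E <= (e `^ (- s))%:E * (b%:E + (C * e `^ m * r `^ (d - m))%:E).
  rewrite fineK//; apply: le_trans Je _.
  by apply: lee_wpmul2l; first by rewrite lee_fin powR_ge0.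
rewrite -EFinD -EFinM !lee_fin in H *.
have es0 : (0 < e `^ s)%R by rewrite powR_gt0.
have eE : (e `^ m = e `^ s * (L * r `^ (m - d)))%R.
  by rewrite -ems -powRD ?subrKC// gt_eqF// implybT.
have CLE : (C * e `^ m * r `^ (d - m) = e `^ s * (c / 2))%R.
  rewrite eE -[(d - m)%R]opprB powRN /L; field.
  by rewrite !gt_eqF ?powR_gt0.
rewrite CLE powRN mulrDr mulKf ?gt_eqF// in H.
(* The claimed bound is exactly the half e^s c/2 that the tail leaves to the ball. *)
have -> : (c / 2 * L `^ (s / (m - s)) * r `^ (s * (m - d) / (m - s)) =
           e `^ s * (c / 2))%R.
  have -> : (e `^ s = L `^ (s / (m - s)) * r `^ (s * (m - d) / (m - s)))%R.
    rewrite -powRrM powRM ?powR_ge0 ?(ltW L0)// -powRrM.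
    by congr (_ `^ _ * _ `^ _)%R; field; rewrite gt_eqF.
  by ring.
have h : (c / 2 <= (e `^ s)^-1 * b)%R by lra.
by rewrite mulrC -ler_pdivlMr// [leRHS]mulrC.
Qed.

(** * Upper bounds on ball masses from the local dimension, and uniformity of lower bounds *)

Lemma gt0_lt_EFin (R : realType) (l : \bar R) : 0 < l ->
  exists2 c : R, (0 < c)%R & c%:E < l.
Proof.
case: l => [r|_|//]; last by exists 1%R => //; exact: ltry.
rewrite lte_fin => r0; exists (r / 2)%R; first by rewrite divr_gt0.
by rewrite lte_fin; lra.
Qed.

Lemma ball_mass_upper_bound (R : realType)
    (mu : {finite_measure set (measurableTypeR R) -> \bar R}) (x d r0 : R) :
  (0 <= d)%R -> (0 < r0)%R ->
  (forall r : R, (0 < r < r0)%R ->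
    mu `[(x - r)%R, (x + r)%R]%classic <= (r `^ d)%:E) ->
  exists2 K : R, (0 < K)%R & forall r : R, (0 < r)%R ->
    mu `[(x - r)%R, (x + r)%R]%classic <= (K * r `^ d)%:E.
Proof.
move=> d0 r00 muB; pose M := fine (mu setT).
have M0 : (0 <= M)%R by exact: fine_ge0.
(* The summand 1 serves r < r0. For r >= r0 the mass is at most M = (M / r0^d) r0^d, and r0^d <= r^d
   because d >= 0. *)
exists (1 + M / r0 `^ d)%R.
  by rewrite ltr_wpDr// divr_ge0// powR_ge0.
move=> r rp; have [rr0|r0r] := ltP r r0.
  apply: le_trans (muB _ _) _; first by rewrite rp.
  rewrite lee_fin ler_peMl ?powR_ge0// lerDl.
  by rewrite divr_ge0// powR_ge0.
apply: (@le_trans _ _ M%:E).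
  rewrite /M fineK ?fin_num_measure//.
  by apply: le_measure; rewrite ?inE//; exact: measurable_itv.
rewrite lee_fin mulrDl -mulrA (@le_trans _ _ (M * ((r0 `^ d)^-1 * r `^ d))%R)//.
  rewrite ler_peMr// mulrC ler_pdivlMr ?powR_gt0// mul1r.
  by apply: ge0_ler_powR; rewrite ?nnegrE ?(ltW r00) ?(ltW rp).
by rewrite lerDr mulr_ge0 ?powR_ge0.
Qed.

Lemma lower_local_dim_ball_mass (R : realType)
    (mu : {finite_measure set (measurableTypeR R) -> \bar R}) (x d : R) :
  (0 <= d)%R -> d%:E < lower_local_dim mu x ->
  exists2 K : R, (0 < K)%R & forall r : R, (0 < r)%R ->
    mu `[(x - r)%R, (x + r)%R]%classic <= (K * r `^ d)%:E.
Proof.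
move=> d0 /lt_limf_einf /near_at_right0 [e0 e00 He].
(* Radii are kept below 1 so that [ln r] is negative and dividing by it reverses the inequality. *)
apply: (ball_mass_upper_bound _ _ _ _ (Num.min e0 1%R)) => //.
  by rewrite lt_min e00 ltr01.
move=> r /andP[r0]; rewrite lt_min => /andP[re0 r1].
have muBfin : mu `[(x - r)%R, (x + r)%R]%classic \is a fin_num.
  by rewrite fin_num_measure//; exact: measurable_itv.
rewrite -(fineK muBfin); set b := fine _.
have : d%:E < lne b%:E * ((ln r)^-1)%:E.
  by rewrite fineK//; apply: He; rewrite r0.
have [b0|b0] := leP b 0%R.
  by move=> _; rewrite lee_fin (le_trans b0)// powR_ge0.
have lnr : (ln r < 0)%R by rewrite ln_lt0// r0.
rewrite lne_EFin// -EFinM lte_fin lee_fin => H.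
rewrite -(ler_ln) ?posrE ?powR_gt0// ln_powR.
by rewrite ltr_ndivlMr// in H; exact: ltW.
Qed.

(* The set where given constants work need not be obviously measurable; its
   closure is, at the cost of a factor 2 in the radius. *)
Lemma uniform_ball_mass_lower_bound (R : realType)
    (mu : {finite_measure set (measurableTypeR R) -> \bar R})
    (A : set (measurableTypeR R)) (a : R) :
  measurable A -> 0 < mu A ->
  (forall x, A x -> exists2 c : R, (0 < c)%R & exists2 r0 : R, (0 < r0)%R &
    forall r : R, (0 < r < r0)%R ->
    (c * r `^ a)%:E <= mu `[(x - r)%R, (x + r)%R]%classic) ->
  exists E : set (measurableTypeR R), [/\ measurable E, 0 < mu E &
    exists2 c : R, (0 < c)%R & exists2 r0 : R, (0 < r0)%R &
    forall x r : R, E x -> (0 < r < r0)%R ->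
    (c * r `^ a)%:E <= mu `[(x - r)%R, (x + r)%R]%classic].
Proof.
move=> mA muA Ac.
pose An (n : nat) : set R := [set x : R | forall r : R, (0 < r < n.+1%:R^-1)%R ->
  (n.+1%:R^-1 * r `^ a)%:E <= mu `[(x - r)%R, (x + r)%R]%classic].
pose E (n : nat) : set (measurableTypeR R) := closure (An n).
have mE n : measurable (E n) by apply: closed_measurable; exact: closed_closure.
have AE : A `<=` \bigcup_n E n.
  move=> x /Ac[c c0 [r0 r00 H]].
  (* Makes 1/(n+1) smaller than both c and r0, so a single index controls both constants. *)
  pose n := Num.truncn (c^-1 + r0^-1).
  have nlt : (c^-1 + r0^-1 < n.+1%:R)%R by rewrite truncnS_gt.
  have c'0 : (0 < c^-1)%R by rewrite invr_gt0.
  have r'0 : (0 < r0^-1)%R by rewrite invr_gt0.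
  have nc : (n.+1%:R^-1 < c)%R.
    by rewrite -[ltRHS]invrK ltf_pV2 ?posrE//; lra.
  have nr : (n.+1%:R^-1 < r0)%R.
    by rewrite -[ltRHS]invrK ltf_pV2 ?posrE//; lra.
  exists n => //; apply: subset_closure => r /andP[rp rn].
  apply: le_trans (H _ _); last by rewrite rp (lt_trans rn).
  by rewrite lee_fin ler_wpM2r ?powR_ge0// ltW.
have [n muE] : exists n, 0 < mu (E n).
  apply: contrapT => /forallNP nE.
  have mu0 n : mu (E n) = 0.
    apply/eqP; rewrite eq_le measure_ge0 andbT leNgt; exact/negP/nE.
  have := measure_sigma_subadditive mu mE mA AE.
  by rewrite eseries0 => [|n _ _]; [rewrite leNgt muA|exact: mu0].
exists (E n); split=> //.
(* A point x of the closure has some y of [An n] within r/2, and the ball of radius r/2 about y lies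
   in the ball of radius r about x; hence the factor 2^(-a). *)
exists (n.+1%:R^-1 * 2^-1 `^ a)%R; first by rewrite mulr_gt0 ?powR_gt0.
exists n.+1%:R^-1%R => // x r Ex /andP[r0 rn].
have r20 : (0 < r / 2)%R by rewrite divr_gt0.
have [y [Any xy]] := Ex _ (nbhsx_ballx x (r / 2)%R r20).
apply: (@le_trans _ _ (mu `[(y - r / 2)%R, (y + r / 2)%R]%classic)).
  apply: le_trans (Any (r / 2)%R _); last by rewrite r20 (le_lt_trans _ rn)//; lra.
  by rewrite lee_fin -mulrA -powRM ?(ltW r0)// [(_ * r)%R]mulrC.
move: xy; rewrite /ball /= ltr_norml => /andP[? ?].
apply: le_measure; rewrite ?inE; try exact: measurable_itv.
by move=> z /=; rewrite !in_itv /= => /andP[? ?]; apply/andP; split; lra.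
Qed.

(** * Lower bound on the mass sum and upper bound on the multifractal dimension *)

(** Here p2 is the mass of a cell, p1 and p3 those of its neighbours, and e the mass of the part of
    E in the cell. With T = p1 + p2 + p3, k^(q-1) e <= T^(q-1) T = T^q, and T is at most three times
    the largest p. *)
Lemma powR_sum3_ge (R : realType) (q k e p1 p2 p3 : R) : (1 < q)%R -> (0 <= k)%R ->
  (0 <= p1)%R -> (0 <= p2)%R -> (0 <= p3)%R -> (0 <= e <= p2)%R -> (k <= p1 + p2 + p3)%R ->
  (k `^ (q - 1) * e <= 3 `^ q * (p1 `^ q + p2 `^ q + p3 `^ q))%R.
Proof.
move=> q1 k0 p10 p20 p30 /andP[e0 ep] kp.
set T := (p1 + p2 + p3)%R in kp.
have T0 : (0 <= T)%R by exact: le_trans kp.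
have q0 : (0 < q)%R by exact: lt_trans q1.
apply: (@le_trans _ _ (T `^ q)%R).
  rewrite -[leRHS]mulr_powRB1// [leLHS]mulrC; apply: ler_pM; rewrite ?powR_ge0//.
    by rewrite /T; lra.
  by apply: ge0_ler_powR; rewrite ?nnegrE// subr_ge0 ltW.
have [M [M0 TM MS]] : exists M, [/\ 0 <= M, T <= 3 * M &
    M `^ q <= p1 `^ q + p2 `^ q + p3 `^ q]%R.
  have h1 := powR_ge0 p1 q; have h2 := powR_ge0 p2 q; have h3 := powR_ge0 p3 q.
  have [p12|p12] := leP p1 p2.
    have [p23|p23] := leP p2 p3; [exists p3|exists p2]; rewrite /T; split=> //; lra.
  have [p13|p13] := leP p1 p3; [exists p3|exists p1]; rewrite /T; split=> //; lra.
apply: (@le_trans _ _ ((3 * M) `^ q)%R).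
  by apply: ge0_ler_powR; rewrite ?nnegrE ?mulr_ge0// ltW.
by rewrite powRM// ler_wpM2l// powR_ge0.
Qed.

Lemma esum_int_shift (R : realType) (f : int -> \bar R) (k : int) :
  \esum_(j in [set: int]) f (j + k)%R = \esum_(j in [set: int]) f j.
Proof.
rewrite [RHS](reindex_esum [set: int] _ (fun j => (j + k)%R))//.
split=> //.
- by move=> i j _ _; exact: addIr.
- by move=> j _; exists (j - k)%R => //; rewrite subrK.
Qed.

Lemma measure_le_esum_int d (T : measurableType d) (R : realType)
    (mu : {measure set T -> \bar R}) (E : set T) (F : int -> set T) :
  measurable E -> (forall j, measurable (F j)) -> E `<=` \bigcup_j F j ->
  mu E <= \esum_(j in [set: int]) mu (F j).
Proof.
move=> mE mF EF; have [e ebij] := bij_nat_int.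
rewrite (reindex_esum _ _ _ _ ebij) -nneseries_esumT//.
apply: measure_sigma_subadditive => // x /EF[j _ Fjx].
by have [_ _ /(_ j Logic.I)[n _ enj]] := ebij; exists n => //; rewrite enj.
Qed.

Lemma esum_int_Zl (R : realType) (k : R) (f : int -> \bar R) :
  (0 <= k)%R -> (forall j, 0 <= f j) ->
  \esum_(j in [set: int]) (k%:E * f j) = k%:E * \esum_(j in [set: int]) f j.
Proof.
move=> k0 f0; have [e ebij] := bij_nat_int.
rewrite !(reindex_esum _ _ _ _ ebij) -!nneseries_esumT; last 2 first.
- by move=> n; exact: f0.
- by move=> n; rewrite mule_ge0.
by rewrite nneseriesZl// => n _; exact: f0.
Qed.

(** The three-cell inequality is summed over all cells, those missing E contributing 0 on the left.
    Each cell is counted once as centre and once as neighbour on either side, hence the factor 3. *)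
Lemma mass_sum_lower_bound (R : realType)
    (mu : {finite_measure set (measurableTypeR R) -> \bar R})
    (E : set (measurableTypeR R)) (q k eps : R) :
  (1 < q)%R -> (0 <= k)%R -> (0 < eps)%R -> measurable E ->
  (forall x : R, E x -> k%:E <= mu `[(x - eps)%R, (x + eps)%R]%classic) ->
  (k `^ (q - 1))%:E * mu E <= (3 `^ q * 3)%:E * mass_sum mu q eps.
Proof.
move=> q1 k0 eps0 mE muE.
pose I (j : int) : set (measurableTypeR R) :=
  `[(j%:~R * eps)%R, ((j + 1)%:~R * eps)%R[%classic.
have mI j : measurable (I j) by exact: measurable_itv.
have Ifin j : mu (I j) \is a fin_num by rewrite fin_num_measure.
pose f (j : int) := mu (I j) `^ q.
have f0 j : 0 <= f j by exact: poweR_ge0.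
have EI : E `<=` \bigcup_j (E `&` I j).
  move=> x Ex; exists (Num.floor (x / eps)) => //; split=> //.
  rewrite /I /= in_itv /=; have /andP[h1 h2] := floor_itv (x / eps)%R.
  by rewrite -ler_pdivlMr// h1 -ltr_pdivrMr.
have mEI j : measurable (E `&` I j) by exact: measurableI.
have step j : (k `^ (q - 1))%:E * mu (E `&` I j) <=
    (3 `^ q)%:E * (f (j + -1)%R + f j + f (j + 1)%R).
  have [->|/set0P[x [Ex Ix]]] := eqVneq (E `&` I j) set0.
    by rewrite measure0 mule0 mule_ge0// ?lee_fin ?powR_ge0// !adde_ge0.
  (* Cells have length eps, so a ball of radius eps centred in one reaches no further than the
     adjacent cells. *)
  have BI : `[(x - eps)%R, (x + eps)%R]%classic `<=`
      I (j + -1)%R `|` I j `|` I (j + 1)%R.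
    move: Ix; rewrite /I /= !in_itv /= !intrD => /andP[h1 h2] z /=.
    rewrite !in_itv /= => /andP[z1 z2].
    have [zj|zj] := ltP z (j%:~R * eps)%R.
      by left; left; apply/andP; split; lra.
    have [zj1|zj1] := ltP z ((j%:~R + 1) * eps)%R.
      by left; right; apply/andP.
    by right; apply/andP; split; lra.
  have : k%:E <= mu (I (j + -1)%R) + mu (I j) + mu (I (j + 1)%R).
    apply: le_trans (muE _ Ex) _.
    apply: (@le_trans _ _ (mu (I (j + -1)%R `|` I j `|` I (j + 1)%R))).
      apply: le_measure; rewrite ?inE//.
      by apply: measurableU => //; exact: measurableU.
    apply: le_trans (measureU2 _ _ _) _ => //; first exact: measurableU.
    by rewrite leeD2r// measureU2.
  have EIfin : mu (E `&` I j) \is a fin_num by rewrite fin_num_measure.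
  have : mu (E `&` I j) <= mu (I j).
    by apply: le_measure; rewrite ?inE//; exact: subIsetr.
  have : 0 <= mu (E `&` I j) by [].
  have Ireal i : exists2 p, (0 <= p)%R & mu (I i) = p%:E.
    by exists (fine (mu (I i))); rewrite ?fine_ge0 ?fineK.
  rewrite /f -(fineK EIfin); move: (fine _) => e.
  have [p1 p10 ->] := Ireal (j + -1)%R.
  have [p2 p20 ->] := Ireal j.
  have [p3 p30 ->] := Ireal (j + 1)%R.
  rewrite !poweR_EFin -!EFinD -!EFinM !lee_fin => e0 ep kp.
  by apply: powR_sum3_ge => //; rewrite e0.
rewrite -[mass_sum mu q eps]/(\esum_(j in [set: int]) f j).
apply: (@le_trans _ _ (\esum_(j in [set: int]) ((k `^ (q - 1))%:E * mu (E `&` I j)))).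
  rewrite esum_int_Zl ?powR_ge0// lee_wpmul2l ?lee_fin ?powR_ge0//.
  exact: measure_le_esum_int.
apply: (@le_trans _ _ (\esum_(j in [set: int])
    ((3 `^ q)%:E * (f (j + -1)%R + f j + f (j + 1)%R)))).
  by apply: le_esum => j _; exact: step.
rewrite esum_int_Zl ?powR_ge0//; last by move=> j; rewrite !adde_ge0.
rewrite esumD; last 2 first.
- by move=> j _; rewrite adde_ge0.
- by move=> j _.
rewrite esumD// (esum_int_shift _ f) (esum_int_shift _ f).
rewrite EFinM -muleA; apply: lee_wpmul2l; first by rewrite lee_fin powR_ge0.
rewrite (_ : 3%:E = 1 + 1 + 1)%E; last by rewrite -!EFinD; congr EFin; ring.
by rewrite !ge0_muleDl ?mul1e// adde_ge0.
Qed.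

(** Applied with u = (q-1) ln eps: since u < 0, a lower bound on the mass sum becomes an upper bound
    on the quotient, and an infinite sum gives [-oo]. *)
Lemma lne_mule_le (R : realType) (S : \bar R) (k b u : R) :
  (0 < k)%R -> (u < 0)%R -> k%:E <= S -> (b * u <= ln k)%R ->
  lne S * (u^-1)%:E <= b%:E.
Proof.
move=> k0 u0; case: S => [r| |//]; last first.
  by move=> _ _; rewrite /= lt0_mulye ?leNye// lte_fin invr_lt0.
rewrite lee_fin => kr bk; have r0 : (0 < r)%R by exact: lt_le_trans kr.
rewrite lne_EFin// -EFinM lee_fin ler_ndivrMr//.
by apply: le_trans bk _; rewrite ler_ln.
Qed.

Lemma upper_mf_dim_le_uniform (R : realType)
    (mu : {finite_measure set (measurableTypeR R) -> \bar R})
    (E : set (measurableTypeR R)) (a c r0 q : R) :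
  measurable E -> 0 < mu E -> (0 < c)%R -> (0 < r0)%R ->
  (forall x r : R, E x -> (0 < r < r0)%R ->
    (c * r `^ a)%:E <= mu `[(x - r)%R, (x + r)%R]%classic) ->
  (1 < q)%R -> upper_mf_dim mu q <= a%:E.
Proof.
move=> mE muE c0 r00 muE_lb q1; apply/lee_addgt0Pr => e e0.
have q10 : (0 < q - 1)%R by rewrite subr_gt0.
have muEfin : mu E \is a fin_num by rewrite fin_num_measure.
have [w w0 wE] : exists2 w, (0 < w)%R & mu E = w%:E.
  by exists (fine (mu E)); rewrite ?fineK// fine_gt0// muE ltey_eq muEfin.
(* The constant in S(q,eps) >= D eps^(a(q-1)). *)
pose D := (c `^ (q - 1) * w / (3 `^ q * 3))%R.
have D0 : (0 < D)%R by rewrite /D divr_gt0 ?mulr_gt0 ?powR_gt0.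
(* Below the last threshold e (q-1) ln eps <= ln D, so the slack e in the exponent absorbs D; the
   bound 1 makes ln eps negative. *)
pose r1 := Num.min r0 (Num.min 1 (expR (ln D / (e * (q - 1)))))%R.
have r10 : (0 < r1)%R by rewrite !lt_min r00 ltr01 expR_gt0.
apply: limf_esup_le; exists r1 => //= eps; rewrite /ball_ /= sub0r normrN => + eps0.
rewrite gtr0_norm// !lt_min => /and3P[er0 e1 eD].
have lneps : (ln eps < 0)%R by rewrite ln_lt0// eps0.
pose k := ((3 `^ q * 3)^-1 * ((c * eps `^ a) `^ (q - 1) * w))%R.
have kE : (k = D * eps `^ (a * (q - 1)))%R.
  rewrite /k /D powRM ?powR_ge0 ?(ltW c0)// -powRrM; field.
  by rewrite gt_eqF ?powR_gt0.
have k0 : (0 < k)%R by rewrite kE mulr_gt0 ?powR_gt0.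
apply: (lne_mule_le _ _ k) => //.
- by rewrite pmulr_rlt0.
- have ce0 : (0 <= c * eps `^ a)%R by rewrite mulr_ge0 ?powR_ge0 ?(ltW c0).
  have := mass_sum_lower_bound _ mu E q _ eps q1 ce0 eps0 mE.
  rewrite wE -EFinM => H.
  rewrite EFinM lee_pdivrMl; last by rewrite mulr_gt0 ?powR_gt0.
  by apply: H => x Ex; apply: muE_lb => //; rewrite eps0.
- rewrite kE lnM ?posrE ?powR_gt0// ln_powR.
  have : (ln eps <= ln D / (e * (q - 1)))%R.
    by rewrite -[leRHS]expRK ler_ln ?posrE ?expR_gt0// ltW.
  rewrite ler_pdivlMr ?mulr_gt0//.
  by lra.
Qed.

Lemma upper_mf_dim_le (R : realType)
    (mu : {finite_measure set (measurableTypeR R) -> \bar R})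
    (A : set (measurableTypeR R)) (a q : R) :
  measurable A -> 0 < mu A ->
  (forall x, A x -> exists2 c : R, (0 < c)%R & exists2 r0 : R, (0 < r0)%R &
    forall r : R, (0 < r < r0)%R ->
    (c * r `^ a)%:E <= mu `[(x - r)%R, (x + r)%R]%classic) ->
  (1 < q)%R -> upper_mf_dim mu q <= a%:E.
Proof.
move=> mA muA /(uniform_ball_mass_lower_bound _ _ _ _ mA muA).
move=> [E [mE muE [c c0 [r0 r00 Ec]]]].
exact: upper_mf_dim_le_uniform mE muE c0 r00 Ec.
Qed.

(** * Comparison of exponents and the two dimension bounds *)

(** If a < d, the hypothesis would give c <= K r^(d-a), whose right side tends to 0 with r. This
    drives the contradiction when delta > s. *)
Lemma powR_exponent_le (R : realType) (c K a d r0 : R) :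
  (0 < c)%R -> (0 < r0)%R -> (forall r, 0 < r < r0 -> c * r `^ a <= K * r `^ d)%R ->
  (d <= a)%R.
Proof.
move=> c0 r00 H; rewrite leNgt; apply/negP => ad.
have da0 : (0 < d - a)%R by rewrite subr_gt0.
have K0 : (0 < K)%R.
  have := H (r0 / 2)%R; rewrite divr_gt0//= => /(_ ltac:(lra)) h.
  have : (0 < K * (r0 / 2) `^ d)%R.
    by apply: lt_le_trans h; rewrite mulr_gt0 ?powR_gt0 ?divr_gt0.
  by rewrite pmulr_lgt0 ?powR_gt0 ?divr_gt0.
(* The solution of K t^(d-a) = c; any radius below it violates the inequality. *)
pose t := ((c / K) `^ (d - a)^-1)%R.
have t0 : (0 < t)%R by rewrite powR_gt0 ?divr_gt0.
pose r := (Num.min r0 t / 2)%R.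
have r2 : (0 < Num.min r0 t)%R by rewrite lt_min r00.
have rp : (0 < r)%R by rewrite divr_gt0.
have rlt : (r < Num.min r0 t)%R by rewrite /r; lra.
move: rlt; rewrite lt_min => /andP[rr0 rt].
have := H r; rewrite rp rr0 => /(_ isT).
have -> : (r `^ d = r `^ (d - a) * r `^ a)%R.
  by rewrite -powRD ?subrK//; apply/implyP => _; rewrite gt_eqF.
rewrite mulrA ler_pM2r ?powR_gt0// leNgt => /negP; apply.
rewrite mulrC -ltr_pdivlMr// -[ltRHS](@powR_invK _ (d - a))//; last 2 first.
- by rewrite divr_ge0 ?ltW.
- by rewrite gt_eqF.
by apply: gt0_ltr_powR; rewrite ?nnegrE ?powR_ge0 ?(ltW rp).
Qed.

Lemma borel_transform_ball_mass (R : realType)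
    (mu : {finite_measure set (measurableTypeR R) -> \bar R})
    (m s x K d : R) :
  (s < m)%R -> (0 < m)%R -> (d < m)%R -> (0 < K)%R ->
  (forall r : R, (0 < r)%R ->
    mu `[(x - r)%R, (x + r)%R]%classic <= (K * r `^ d)%:E) ->
  0 < limf_einf (fun eps : R =>
    (eps `^ (- s))%:E * borel_transform mu m x eps) (0%R : R)^'+ ->
  exists2 c : R, (0 < c)%R & exists2 r0 : R, (0 < r0)%R &
    forall r : R, (0 < r < r0)%R ->
    (c * r `^ (s * (m - d) / (m - s)))%:E <= mu `[(x - r)%R, (x + r)%R]%classic.
Proof.
move=> sm m0 dm K0 muB /gt0_lt_EFin[c c0] /lt_limf_einf/near_at_right0[e0 e00 He].
apply: (ball_mass_lower_bound _ _ _ _ _ _ _ _ _ sm m0 dm K0 c0 e00 muB).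
by move=> eps /He /ltW.
Qed.

Theorem corollary1p6 (R : realType)
  (mu : {finite_measure set (measurableTypeR R) -> \bar R})
  (mu_continuous : forall x : R, mu [set x] = 0)
  (m s : R) (s_ge0 : (0 <= s)%R) (s_lt_m : (s < m)%R)
  (A : set (measurableTypeR R)) (mA : measurable A) (muA_gt0 : 0 < mu A)
  (J_lower : forall x : R, A x ->
    0 < limf_einf (fun eps : R =>
          (eps `^ (- s))%:E * borel_transform mu m x eps) (0%R : R)^'+) :
  (forall q : R, (1 < q)%R ->
     upper_mf_dim mu q <= ((m * s / (m - s))%R)%:E) /\
  (forall delta : R, (0 < delta)%R ->
     (forall x : R, A x -> delta%:E <= lower_local_dim mu x) ->
     forall q : R, (1 < q)%R ->
       upper_mf_dim mu q <= ((s * (m - delta) / (m - s))%R)%:E).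
Proof.
have m0 : (0 < m)%R by exact: le_lt_trans s_lt_m.
have ms0 : (0 < m - s)%R by rewrite subr_gt0.
split=> [q q1|delta delta0 Adelta q q1].
(* The first bound is the case d = 0, with the total mass plus 1 as a positive K. *)
- have -> : (m * s / (m - s) = s * (m - 0) / (m - s))%R by rewrite subr0 [(m * s)%R]mulrC.
  apply: (upper_mf_dim_le _ _ _ _ _ mA muA_gt0) => // x Ax.
  have [K K0 muK] : exists2 K : R, (0 < K)%R & forall r : R, (0 < r)%R ->
      mu `[(x - r)%R, (x + r)%R]%classic <= (K * r `^ 0)%:E.
    exists (fine (mu setT) + 1)%R => [|r r0]; first by rewrite ltr_wpDl// fine_ge0.
    rewrite powRr0 mulr1 EFinD fineK ?fin_num_measure// -[leLHS]adde0 leeD//.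
    by apply: le_measure; rewrite ?inE//; exact: measurable_itv.
  exact: (borel_transform_ball_mass _ _ _ _ _ _ _ s_lt_m m0 m0 K0 muK (J_lower _ Ax)).
(* A lower limit that is at least delta yields eventual bounds only for exponents strictly below
   delta. *)
have decay (d : R) : (0 <= d < m)%R -> (d < delta)%R -> forall x, A x ->
    exists2 K : R, (0 < K)%R & forall r : R, (0 < r)%R ->
      mu `[(x - r)%R, (x + r)%R]%classic <= (K * r `^ d)%:E.
  move=> /andP[d0 dm] ddelta x Ax; apply: lower_local_dim_ball_mass => //.
  by apply: lt_le_trans (Adelta _ Ax); rewrite lte_fin.
have [sdelta|deltas] := ltP s delta.
- (* Contradictory case: the masses would decay too fast. *)
  have [x Ax] : exists x, A x.
    apply/set0P; apply: contraPneq muA_gt0 => ->.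
    by rewrite measure0 ltxx.
  pose d := ((s + Num.min delta m) / 2)%R.
  have : (s < Num.min delta m)%R by rewrite lt_min sdelta.
  move=> smin; have : (d < Num.min delta m)%R by rewrite /d; lra.
  rewrite lt_min => /andP[ddelta dm].
  have sd : (s < d)%R by rewrite /d; lra.
  have d0 : (0 <= d)%R by rewrite (le_trans s_ge0)// ltW.
  have [K K0 muK] := decay d ltac:(by rewrite d0) ddelta x Ax.
  have [c c0 [r0 r00 H]] := borel_transform_ball_mass _ _ _ _ _ _ _
    s_lt_m m0 dm K0 muK (J_lower _ Ax).
  have : (d <= s * (m - d) / (m - s))%R.
    apply: (powR_exponent_le _ c K _ _ r0) => // r rr0.
    rewrite -lee_fin; apply: le_trans (H _ rr0) (muK _ _).
    by case/andP : rr0.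
  (* Clearing denominators, d(m-s) <= s(m-d) reduces to dm <= sm, against s < d. *)
  rewrite ler_pdivlMr// => h; exfalso; nra.
apply/lee_addgt0Pr => e e0.
have s0 : (0 < s)%R by exact: lt_le_trans deltas.
(* Replacing delta by d raises the exponent by s(delta-d)/(m-s), which this choice keeps at most e;
   the maximum with 0 keeps d admissible in [decay]. *)
pose d := Num.max 0%R (delta - e * (m - s) / s)%R.
have d0 : (0 <= d)%R by rewrite le_max lexx.
have ddelta : (d < delta)%R by rewrite gt_max delta0 ltrBlDr ltrDl divr_gt0 ?mulr_gt0.
have dm : (d < m)%R by rewrite (lt_trans ddelta)// (le_lt_trans deltas).
apply: (@le_trans _ _ (s * (m - d) / (m - s))%:E).
  apply: (upper_mf_dim_le _ _ _ _ _ mA muA_gt0) => // x Ax.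
  have [K K0 muK] := decay d ltac:(by rewrite d0) ddelta x Ax.
  exact: (borel_transform_ball_mass _ _ _ _ _ _ _ s_lt_m m0 dm K0 muK (J_lower _ Ax)).
rewrite -EFinD lee_fin ler_pdivrMr// mulrDl divfK ?gt_eqF//.
have : (delta - e * (m - s) / s <= d)%R by rewrite le_max lexx orbT.
rewrite lerBlDr -lerBlDl ler_pdivlMr//; lra.
Qed.
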